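(* Let $n\ge 1$. Each evaluation scheme of order $n$ below satisfies $\Phi(k)=[\,k=\mathbf 1\,]$ for all $k\in\mathbb{Z}_{\ge 0}^{\,n}$ with $|k|=n$ (in case (F), under the condition stated there), and hence computes the permanent, i.e. $T[B]=\operatorname{per}B$ for every $B\in\mathbb{C}^{n\times n}$. (R) (Ryser) The index set $R$ is the set of subsets $S\subseteq\{0,\dots,n-1\}$ (identified with $\{0,1\}^n$), $v_S=\chi_S\in\{0,1\}^n$ is the indicator vector of $S$, $w_S=(-1)^{\,n-|S|}$, and $c=1$. (G) (Glynn) $R=\{\delta\in\{\pm1\}^n:\delta_0=1\}$, $v_\delta=\delta$, $w_\delta=\prod_{j=0}^{n-1}\delta_j$, and $c=2^{-(n-1)}$. (F) (Cyclic DFT) Given a positive integer $N$ and a set $A=\{a_0<\dots<a_{n-1}\}\subseteq\mathbb{Z}_N$ of $n$ distinct residues, with $p:=\sum_j a_j \pmod N$: $R=\{0,\dots,N-1\}$, $v_{r,j}=\omega^{a_j r}$ with $\omega=e^{2\pi i/N}$, $w_r=\omega^{-pr}$, and $c=1/N$. This scheme satisfies $\Phi(k)=[\,k=\mathbf 1\,]$ for all $k\in\mathbb{Z}_{\ge 0}^{\,n}$ with $|k|=n$ if and only if $A$ is valid mod $N$.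
   Context: Matrices $B=(b_{ij})\in\mathbb{C}^{n\times n}$ have rows indexed by $i=1,\dots,n$ and columns indexed by $j=0,\dots,n-1$; vectors in $\mathbb{C}^n$ have coordinates indexed by $0,\dots,n-1$. The permanent is $\operatorname{per} B=\sum_{\sigma}\prod_{i=1}^n b_{i\sigma(i)}$, the sum being over all bijections $\sigma:\{1,\dots,n\}\to\{0,\dots,n-1\}$. An evaluation scheme of order $n$ is a finite family of vectors $v_r\in\mathbb{C}^n$ ($r\in R$) with weights $w_r\in\mathbb{C}$ and a constant $c\in\mathbb{C}$. Its transform sum is $$T[B]=c\sum_{r\in R} w_r\prod_{i=1}^n\Bigl(\sum_{j=0}^{n-1} b_{ij}v_{r,j}\Bigr),\qquad B\in\mathbb{C}^{n\times n},$$ and for $k\in\mathbb{Z}_{\ge0}^{\,n}$ with $|k|:=\sum_j k_j=n$, $$\Phi(k)=c\sum_{r\in R} w_r\prod_{j=0}^{n-1} v_{r,j}^{\,k_j}\qquad(\text{with } t^0:=1,\text{ also for } t=0).$$ Here $\mathbf 1=(1,\dots,1)$ and $[\,\cdot\,]$ is the Iverson bracket. A set $A=\{a_0<\dots<a_{n-1}\}\subseteq\mathbb{Z}_N$ (integers modulo $N$, represented by $0,\dots,N-1$) is valid mod $N$ if the all-ones multiset (each element of $A$ taken exactly once) is the only size-$n$ multiset with elements from $A$ whose sum is $p:=\sum_j a_j\pmod N$; equivalently, the only $k\in\mathbb{Z}_{\ge0}^{\,n}$ with $|k|=n$ and $\sum_j k_ja_j\equiv p\pmod N$ is $k=\mathbf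 1$. *)

(* Defs.v *)
(* The complex numbers are R[i] for R : realType. *)
From HB Require Import structures.
From mathcomp Require Export all_boot all_order all_fingroup all_algebra.
From mathcomp Require Export complex reals.
From mathcomp Require Import sequences exp trigo.

Set Implicit Arguments.
Unset Strict Implicit.
Unset Printing Implicit Defensive.

Import Order.TTheory GRing.Theory Num.Theory.

Local Open Scope ring_scope.
Local Open Scope complex_scope.

(* Rows, columns and coordinates are all indexed by 'I_n = {0, ..., n-1}, so a
   row called i in 1-based numbering is row i-1 here, and the bijections from
   rows to columns are the permutations of 'I_n. *)
Definition per (K : fieldType) (n : nat) (B : 'M[K]_n) : K :=
  \sum_(s : 'S_n) \prod_(i < n) B i (s i).

Record eval_scheme (K : fieldType) (n : nat) := EvalScheme {
  es_index : finType;
  es_vec : es_index -> 'rV[K]_n;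
  es_weight : es_index -> K;
  es_const : K
}.

Definition transform_sum (K : fieldType) (n : nat) (E : eval_scheme K n)
    (B : 'M[K]_n) : K :=
  es_const E * \sum_(r : es_index E)
    es_weight r * \prod_(i < n) \sum_(j < n) B i j * es_vec r 0 j.

Definition Phi (K : fieldType) (n : nat) (E : eval_scheme K n)
    (k : {ffun 'I_n -> nat}) : K :=
  es_const E * \sum_(r : es_index E)
    es_weight r * \prod_(j < n) es_vec r 0 j ^+ k j.

Definition Phi_isolates_ones (K : fieldType) (n : nat)
    (E : eval_scheme K n) : Prop :=
  forall k : {ffun 'I_n -> nat},
    (\sum_(j < n) k j = n)%N -> Phi E k = (k == [ffun=> 1%N])%:R.

Definition computes_per (K : fieldType) (n : nat)
    (E : eval_scheme K n) : Prop :=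
  forall B : 'M[K]_n, transform_sum E B = per B.

Definition ryser (K : fieldType) (n : nat) : eval_scheme K n :=
  @EvalScheme K n {set 'I_n}
    (fun S => \row_(j < n) (j \in S)%:R)
    (fun S => (-1) ^+ (n - #|S|))
    1.

(* A sign vector delta in {1, -1}^n is encoded by booleans: the coordinate
   delta_j is (-1) ^+ d j, so that delta_0 = 1 reads d 0 = false. *)
Definition glynn_index (n : nat) : finType :=
  {d : {ffun 'I_n -> bool} | [forall j : 'I_n, (j == 0%N :> nat) ==> ~~ d j]}.

Definition glynn (K : fieldType) (n : nat) : eval_scheme K n :=
  @EvalScheme K n (glynn_index n)
    (fun d => \row_(j < n) (-1) ^+ (val d j))
    (fun d => \prod_(j < n) (-1) ^+ (val d j))
    (2 ^- n.-1).

Definition cexp (R : realType) (z : R[i]) : R[i] :=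
  (expR (complex.Re z))%:C * (cos (complex.Im z) +i* sin (complex.Im z)).

Definition omega (R : realType) (N : nat) : R[i] :=
  cexp (2 * (pi : R)%:C * (0 +i* 1) / N%:R).

(* Residues modulo N are their representatives in 'I_N; a : 'I_n -> 'I_N lists
   the elements a_0, ..., a_(n-1). *)
Definition cyclic_dft (R : realType) (n N : nat) (a : 'I_n -> 'I_N) :
    eval_scheme R[i] n :=
  let p := ((\sum_(j < n) a j) %% N)%N in
  @EvalScheme R[i] n 'I_N
    (fun r => \row_(j < n) omega R N ^+ (a j * r))
    (fun r => omega R N ^- (p * r))
    (N%:R^-1).

(* A multiset of residues is given by its multiplicity function m; the all-ones
   multiset is the indicator function of A. *)
Definition valid_mod (N : nat) (A : {set 'I_N}) : Prop :=
  forall m : {ffun 'I_N -> nat},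
    (forall x, x \notin A -> m x = 0%N) ->
    (\sum_(x : 'I_N) m x = #|A|)%N ->
    (\sum_(x : 'I_N) m x * x = \sum_(x in A) x %[mod N])%N ->
    m = [ffun x => nat_of_bool (x \in A)].

(* Main.v *)
(* Expanding the product of row sums gives T[B] = sum_f (prod_i b_(i, f i))
   Phi(k_f), where f ranges over all maps from rows to columns and k_f counts
   the fibers of f; since k_f = 1 exactly when f is a bijection, isolating the
   all-ones vector implies computing the permanent.  Each Phi is explicit:
   inclusion-exclusion turns the Ryser sum into prod_j [k_j > 0], the Glynn sum
   becomes prod_(j > 0) [k_j odd] (and then k_0 is odd by parity of |k| = n),
   and orthogonality of the powers of omega turns the DFT sum into
   [sum_j k_j a_j = p mod N]. *)
Require Import Defs.
From mathcomp Require Import sequences exp trigo.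
From mathcomp Require Import ring lra.

Set Implicit Arguments.
Unset Strict Implicit.
Unset Printing Implicit Defensive.

Import Order.TTheory GRing.Theory Num.Theory.
Local Open Scope ring_scope.
Local Open Scope complex_scope.

(** * Maps, their fiber sizes, and the expansion of the transform sum *)

Lemma big_perm_injective (K : fieldType) n (F : {ffun 'I_n -> 'I_n} -> K) :
  \sum_(f : {ffun 'I_n -> 'I_n} | injectiveb f) F f =
  \sum_(s : 'S_n) F (pval s).
Proof.
rewrite (reindex (@pval _)) /=; last first.
  (* A permutation is stored as an injective finite function; [in_Sn] inverts [pval] there and
     defaults to the identity elsewhere. *)
  pose in_Sn := insubd (1%g : 'S_n).
  by exists in_Sn => /= f Uf; first apply: val_inj; apply: insubdK.
by apply: eq_bigl => s; rewrite (valP s).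
Qed.

(** Equality case of the termwise bound [1 <= k j]: both sides add up to [n]. *)
Lemma sum_ord_all_pos n (k : {ffun 'I_n -> nat}) :
  (\sum_(j < n) k j = n)%N -> [forall j, (0 < k j)%N] = (k == [ffun=> 1%N]).
Proof.
move=> sum_k; apply/forallP/eqP => [k_gt0 | -> j]; last by rewrite ffunE.
have := @leqif_sum 'I_n predT (fun j => 1 == k j)%N (fun _ => 1%N) k
  (fun j _ => leqif_eq (k_gt0 j)).
rewrite sum_k sum1_card card_ord => -[_ /esym]; rewrite eqxx => /forallP k1.
by apply/ffunP => j; rewrite ffunE; apply/esym/eqP/k1.
Qed.

Definition fiber_card n (f : {ffun 'I_n -> 'I_n}) : {ffun 'I_n -> nat} :=
  [ffun j => #|[pred i | f i == j]|].

Lemma sum_fiber_card n (f : {ffun 'I_n -> 'I_n}) :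
  (\sum_(j < n) fiber_card f j = n)%N.
Proof.
transitivity (\sum_(i < n) 1)%N; last by rewrite sum1_card card_ord.
rewrite [RHS](partition_big f predT) //=.
by apply: eq_bigr => j _; rewrite ffunE -sum1_card.
Qed.

Lemma prod_fiber_card (K : fieldType) n (f : {ffun 'I_n -> 'I_n})
    (v : 'I_n -> K) :
  \prod_(i < n) v (f i) = \prod_(j < n) v j ^+ fiber_card f j.
Proof.
rewrite [LHS](partition_big f predT) //=; apply: eq_bigr => j _.
rewrite ffunE -prodr_const.
by apply: eq_big => // i /eqP ->.
Qed.

(** As the fiber sizes add up to [n], all being 1 means none is empty, that is, [f] is onto; on a
    finite set this is injectivity. *)
Lemma fiber_card_eq1 n (f : {ffun 'I_n -> 'I_n}) :
  (fiber_card f == [ffun=> 1%N]) = injectiveb f.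
Proof.
rewrite -sum_ord_all_pos ?sum_fiber_card //.
apply/forallP/injectiveP => [f_onto | f_inj j].
  suff f_on : codom f =i predT.
    apply/injectiveP/card_uniqP.
    by rewrite size_codom (eq_card f_on).
  move=> j; rewrite inE; have := f_onto j; rewrite ffunE.
  by case/card_gt0P => i; rewrite inE => /eqP <-; apply: codom_f.
rewrite ffunE; apply/card_gt0P; exists (invF f_inj j).
by rewrite inE f_invF.
Qed.

Lemma transform_sum_Phi (K : fieldType) n (E : eval_scheme K n) (B : 'M[K]_n) :
  transform_sum E B =
  \sum_(f : {ffun 'I_n -> 'I_n})
    (\prod_(i < n) B i (f i)) * Phi E (fiber_card f).
Proof.
rewrite /transform_sum /Phi big_distrr /=.
under eq_bigr => r _.
  rewrite (bigA_distr_bigA (fun i j => B i j * es_vec r 0 j)) /= !big_distrr /=.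
  over.
rewrite exchange_big; apply: eq_bigr => f _ /=.
rewrite !big_distrr /=; apply: eq_bigr => r _.
rewrite big_split /= (prod_fiber_card f (es_vec r 0)).
by rewrite [in RHS]mulrCA; congr (_ * _); rewrite mulrCA.
Qed.

Lemma isolates_computes_per (K : fieldType) n (E : eval_scheme K n) :
  Phi_isolates_ones E -> computes_per E.
Proof.
move=> isoE B; rewrite transform_sum_Phi.
rewrite (bigID (fun f : {ffun _ -> _} => injectiveb f)) /=.
rewrite [X in _ + X]big1 ?addr0 => [|f /negbTE f_ninj]; last first.
  by rewrite isoE ?sum_fiber_card // fiber_card_eq1 f_ninj mulr0.
rewrite big_perm_injective; apply: eq_bigr => s _.
rewrite isoE ?sum_fiber_card // fiber_card_eq1 (valP s) mulr1.
by apply: eq_bigr => i _; rewrite pvalE.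
Qed.

(** * Ryser's scheme *)

Lemma prod_bool_forall (K : fieldType) (I : finType) (P : pred I) :
  \prod_i (P i)%:R = ([forall i, P i])%:R :> K.
Proof.
case: forallP => [allP | /forallP]; first by rewrite big1 // => i _; rewrite allP.
by rewrite negb_forall => /existsP[i /negbTE Pi]; rewrite (bigD1 i) //= Pi mul0r.
Qed.

Lemma ryser_isolates (K : fieldType) n : Phi_isolates_ones (ryser K n).
Proof.
move=> k sum_k; rewrite -sum_ord_all_pos // -prod_bool_forall /Phi /= mul1r.
(* Expanding this product over subsets [S] picks 1 for [j] in [S] and [-[k j = 0] = -0 ^+ k j]
   otherwise, which is the Ryser summand. *)
transitivity (\prod_(j < n) (1 + (- ((k j == 0)%N)%:R : K))); last first.
  by apply: eq_bigr => j _; case: (k j) => [|m]; rewrite /= ?subrr ?subr0.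
rewrite bigA_distr; apply: eq_big => // S _.
rewrite [in LHS]mulrC.
(* The exponent is the size of the complement of [S], so each [j] outside [S] carries one sign. *)
have -> : (-1) ^+ (n - #|S|) = \prod_(j < n) (if j \in S then 1 else -1) :> K.
  rewrite -[n in (n - _)%N]card_ord -(setCK S) -cardsCs -prodr_const big_mkcond.
  by apply: eq_bigr => j _; rewrite !inE; case: (j \in S).
rewrite -big_split /=; apply: eq_bigr => j _.
by rewrite mxE; case: (j \in S); rewrite ?expr1n ?mulr1 // expr0n mulrN1.
Qed.

(** * Glynn's scheme *)

Lemma odd_sum_ord n (F : 'I_n -> nat) :
  (forall i, odd (F i)) -> odd (\sum_(i < n) F i) = odd n.
Proof.
move=> F_odd; rewrite -[in RHS](card_ord n) -sum1_card.
apply: (big_ind2 (fun x y => odd x = odd y)) => // [x1 x2 y1 y2|i _].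
  by rewrite !oddD => -> ->.
by rewrite F_odd.
Qed.

Lemma glynn_isolates (K : fieldType) n : (0 < n)%N -> (2 : K) != 0 ->
  Phi_isolates_ones (glynn K n).
Proof.
case: n => // n _ K2 k sum_k; rewrite /Phi /=.
(* Giving weight 0 to delta_0 = -1 lets delta range over all sign vectors. *)
pose G (j : 'I_n.+1) (b : bool) : K :=
  if (j == 0%N :> nat) && b then 0 else (-1) ^+ (b * (k j).+1).
have -> : \sum_(d : glynn_index n.+1)
    \prod_(j < n.+1) (-1) ^+ val d j *
    \prod_(j < n.+1) (\row_(j0 < n.+1) (-1) ^+ val d j0 : 'rV[K]__) 0 j ^+ k j
  = \sum_(d : {ffun 'I_n.+1 -> bool}) \prod_j G j (d j).
  rewrite [RHS](bigID (fun d : {ffun 'I_n.+1 -> bool} =>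
    [forall j : 'I_n.+1, (j == 0%N :> nat) ==> ~~ d j])) /=.
  rewrite [X in _ = _ + X]big1 ?addr0 => [|d]; last first.
    rewrite negb_forall => /existsP[j]; rewrite negb_imply negbK => jd.
    by rewrite (bigD1 j) //= /G jd mul0r.
  rewrite [RHS]big_sub /=.
  apply: eq_bigr => d _; rewrite -big_split /=; apply: eq_bigr => j _.
  (* The weight supplies one more factor [delta_j], hence the exponent [(k j).+1] in [G]. *)
  rewrite mxE -exprM -exprD /G -mulnS.
  case: ifP => // /andP[j0 dj]; have /forallP/(_ j) := valP d.
  by rewrite j0 dj.
rewrite -bigA_distr_bigA /= big_ord_recl big_bool /=.
rewrite {1 2}/G /= add0r mul0n expr0 mul1r.
(* Coordinate 0 has contributed the factor 1. Each other one gives [1 + (-1) ^+ (k j).+1], and the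
   resulting powers of 2 cancel the constant of the scheme. *)
have -> : \prod_(i < n) \sum_(b : bool) G (lift ord0 i) b =
   \prod_(i < n) (2 * (odd (k (lift ord0 i)))%:R).
  apply: eq_bigr => i _; rewrite big_bool /G /= mul1n mul0n expr0 -signr_odd /=.
  by case: odd; rewrite /= ?expr0 ?expr1 ?mulr1 ?mulr0 // addNr.
rewrite big_split /= prodr_const card_ord mulrA mulVf ?expf_neq0 // mul1r.
rewrite prod_bool_forall -sum_ord_all_pos //; congr (nat_of_bool _)%:R.
apply/forallP/forallP => [k_odd | k_gt0].
  have k_gt0 i : (0 < k (lift ord0 i))%N by rewrite odd_gt0.
  move=> j; case: (unliftP ord0 j) => [i | ] -> //.
  (* The order is now [n.+1]: the [n] other entries are odd, so [k ord0 = 0] would give the total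
     [n.+1] the parity of [n]. *)
  have := congr1 odd sum_k; rewrite big_ord_recl oddD odd_sum_ord //.
  by case: (k ord0) => //=; case: (odd n).
move=> i.
have /eqP -> : k == [ffun=> 1%N] by rewrite -sum_ord_all_pos //; apply/forallP.
by rewrite ffunE.
Qed.

(** * [omega] is a primitive root of unity *)

Lemma omegaE (R : realType) N (t := 2 * pi / N%:R : R) :
  omega R N = cos t +i* sin t.
Proof.
have -> : omega R N = cexp (0 +i* t).
  rewrite /omega; congr cexp.
  have -> : (N%:R : R[i]) = (N%:R : R)%:C by rewrite rmorph_nat.
  rewrite -fmorphV; apply/eqP; rewrite eq_complex /= /t.
  by apply/andP; split; apply/eqP; ring.
rewrite /cexp /= expR0; apply/eqP; rewrite eq_complex /=.
by rewrite !mul1r !mul0r subr0 addr0 !eqxx.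
Qed.

Lemma de_Moivre (R : realType) (t : R) m :
  (cos t +i* sin t) ^+ m = cos (t *+ m) +i* sin (t *+ m).
Proof.
elim: m => [|m IH]; first by rewrite expr0 mulr0n cos0 sin0.
rewrite exprS IH mulrS cosD sinD; congr (_ +i* _).
by rewrite addrC.
Qed.

(** Half-angle formula [cos t = 1 - 2 sin^2 (t/2)], with [t/2] strictly between 0 and [pi]. *)
Lemma cos_lt1 (R : realType) (t : R) : 0 < t < 2 * pi -> cos t < 1.
Proof.
move=> /andP[t_gt0 t_lt].
have /sin_gt0_pi s_gt0 : 0 < t / 2 < pi by apply/andP; split; lra.
have -> : t = (t / 2) *+ 2 by rewrite -mulr_natr divfK ?pnatr_eq0.
rewrite cos_mulr2n.
have := cos2Dsin2 (t / 2); have := exprn_gt0 2 s_gt0.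
lra.
Qed.

Lemma omega_prim (R : realType) N : (0 < N)%N -> N.-primitive_root (omega R N).
Proof.
move=> N_gt0; have N0 : (N%:R : R) != 0 by rewrite pnatr_eq0 -lt0n.
have NR_gt0 : 0 < (N%:R : R) by rewrite ltr0n.
rewrite /primitive_root_of_unity N_gt0 /=; apply/forallP => i.
rewrite unity_rootE omegaE de_Moivre.
have -> : 2 * pi / N%:R *+ i.+1 = 2 * pi * (i.+1%:R / N%:R) :> R.
  by rewrite -mulr_natr -mulrA [_^-1 * _]mulrC.
have [-> | iN] := eqVneq i.+1 N.
  by rewrite divff // mulr1 mulr_natl cos2pi sin2pi eqxx.
(* For [0 < i.+1 < N] the angle lies strictly inside a full turn, so the real part of the power
   already differs from 1. *)
rewrite eqbF_neg eq_complex /= negb_and lt_eqF // cos_lt1 //.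
have pi2 : 0 < 2 * pi :> R by rewrite mulr_gt0 // pi_gt0.
rewrite mulr_gt0 ?divr_gt0 //= gtr_pMr // ltr_pdivrMr // mul1r ltr_nat.
by rewrite ltn_neqAle iN ltn_ord.
Qed.

(** * The cyclic DFT scheme and validity *)

Lemma sum_prim_root_expr (F : fieldType) N (z : F) (m : nat) :
  N.-primitive_root z -> \sum_(r < N) (z ^+ m) ^+ r = (N * (N %| m)%N)%:R.
Proof.
move=> z_prim; rewrite (prim_order_dvd z_prim).
have [zm1 | zm1] := eqVneq (z ^+ m) 1.
  rewrite muln1 zm1; under eq_bigr do rewrite expr1n.
  by rewrite sumr_const card_ord.
(* Geometric series: multiplied by the nonzero [z ^+ m - 1], the sum becomes
   [z ^+ (m * N) - 1 = 0]. *)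
rewrite muln0; apply: (mulfI (x := z ^+ m - 1)); first by rewrite subr_eq0.
by rewrite -subrX1 -exprM mulnC exprM (prim_expr_order z_prim) expr1n subrr mulr0.
Qed.

Lemma Phi_cyclic_dft (R : realType) n N (a : 'I_n -> 'I_N)
    (k : {ffun 'I_n -> nat}) : (0 < N)%N ->
  Phi (cyclic_dft R a) k =
  (\sum_(j < n) k j * a j == \sum_(j < n) a j %[mod N])%:R.
Proof.
move=> N_gt0; rewrite /Phi /=.
move: (omega R N) (omega_prim R N_gt0) => w w_prim; set s := (\sum_(j < n) a j)%N.
set q := (\sum_(j < n) k j * a j)%N; set p := (s %% N)%N.
have p_lt : (p < N)%N by rewrite ltn_mod.
have w_neq0 m : w ^+ m != 0.
  apply/expf_neq0/(contra_eqN _ (prim_expr_order w_prim)) => /eqP ->.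
  by rewrite expr0n gtn_eqF // eq_sym oner_eq0.
(* Trading [-p] for [N - p] keeps all exponents natural numbers. *)
have wVp : w ^- p = w ^+ (N - p).
  apply: (mulfI (w_neq0 p)); rewrite mulfV // -exprD subnKC 1?ltnW //.
  by rewrite prim_expr_order.
have -> : \sum_(r < N) w ^- (p * r) *
    \prod_(j < n) (\row_(j0 < n) w ^+ (a j0 * r)) 0 j ^+ k j =
    \sum_(r < N) (w ^+ (N - p + q)) ^+ r.
  apply: eq_bigr => r _.
  rewrite exprM -exprVn wVp exprD exprMn; congr (_ * _).
  rewrite /q -exprM big_distrl /= -prodrXr.
  by apply: eq_bigr => j _; rewrite mxE -exprM [in LHS]mulnC mulnA.
rewrite sum_prim_root_expr // natrM mulrA mulVf ?mul1r; last first.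
  by rewrite pnatr_eq0 -lt0n.
congr (nat_of_bool _)%:R.
(* Adding [N - p] to both sides of [q = s] modulo [N] turns the right one into 0. *)
rewrite /p -(eqn_modDl (N - p) q s) -[in RHS](modnDmr _ s) -/p.
by rewrite subnK ?modnn // ltnW.
Qed.

(** Since [a] is a bijection onto [A], vectors [k] correspond to multiplicity functions [m]
    supported on [A] by [k j = m (a j)], and [Phi] is the indicator of the congruence that validity
    tests. *)
Lemma cyclic_dft_isolatesP (R : realType) n N (A : {set 'I_N})
    (a : 'I_n -> 'I_N) :
  (0 < N)%N -> injective a -> A = [set a j | j : 'I_n] ->
  Phi_isolates_ones (cyclic_dft R a) <-> valid_mod A.
Proof.
move=> N_gt0 a_inj defA.
have sumA (F : 'I_N -> nat) : (\sum_(x in A) F x = \sum_(j < n) F (a j))%N.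
  by rewrite defA big_imset //= => ? ? _ _; apply: a_inj.
have sum0A (F : 'I_N -> nat) : (forall x, x \notin A -> F x = 0%N) ->
    (\sum_x F x = \sum_(j < n) F (a j))%N.
  move=> F0; rewrite (bigID (mem A)) /= sumA [X in (_ + X)%N]big1 ?addn0 //.
have cardA : #|A| = n by rewrite defA card_imset // card_ord.
have aA j : a j \in A by rewrite defA imset_f.
split=> [isoE m mA sum_m sum_mx | validA k sum_k].
  pose k := [ffun j => m (a j)].
  have sum_k : (\sum_(j < n) k j = n)%N.
    rewrite -[RHS]cardA -sum_m sum0A //.
    by apply: eq_bigr => j _; rewrite ffunE.
  have := isoE k sum_k; rewrite Phi_cyclic_dft //.
  have -> : (\sum_(j < n) k j * a j = \sum_x m x * x)%N.
    rewrite (sum0A (fun x => m x * x)%N) => [|x /mA -> //].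
    by apply: eq_bigr => j _; rewrite ffunE.
  rewrite sum_mx sumA eqxx; case: eqP => [k1 _ | _ /eqP]; last by rewrite oner_eq0.
  apply/ffunP => x; rewrite ffunE; case: (boolP (x \in A)) => [|/mA //].
  rewrite defA => /imsetP[j _ ->].
  by have /ffunP/(_ j) := k1; rewrite !ffunE.
rewrite Phi_cyclic_dft //; congr (nat_of_bool _)%:R.
apply/eqP/eqP => [eq_k | ->]; last first.
  by congr (_ %% _)%N; apply: eq_bigr => j _; rewrite ffunE mul1n.
(* Push-forward of [k] along [a]: by injectivity the sum has one term at each [a j], and it is empty
   off [A]. *)
pose m := [ffun x => (\sum_(j < n | a j == x) k j)%N].
have ma j : m (a j) = k j.
  by rewrite ffunE (eq_bigl (pred1 j)) ?big_pred1_eq // => i; rewrite inj_eq.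
have mA x : x \notin A -> m x = 0%N.
  by move=> xA; rewrite ffunE big1 // => j /eqP ax; rewrite -ax aA in xA.
have := validA m mA; rewrite sumA cardA.
rewrite (sum0A m) // (sum0A (fun x => m x * x)%N) => [|x /mA -> //].
under eq_bigr do rewrite ma.
under [in X in _ -> X -> _]eq_bigr do rewrite ma.
move=> /(_ sum_k eq_k) m1; apply/ffunP => j.
by rewrite -ma m1 !ffunE aA.
Qed.

Theorem proposition2 (R : realType) (n : nat) (hn : (0 < n)%N) :
  (* (R) *)
  (Phi_isolates_ones (ryser R[i] n) /\ computes_per (ryser R[i] n)) /\
  (* (G) *)
  (Phi_isolates_ones (glynn R[i] n) /\ computes_per (glynn R[i] n)) /\
  (* (F) *)
  (forall (N : nat) (A : {set 'I_N}) (a : 'I_n -> 'I_N),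
     (0 < N)%N ->
     (forall i j : 'I_n, (i < j)%N -> (a i < a j)%N) ->
     A = [set a j | j : 'I_n] ->
     (Phi_isolates_ones (cyclic_dft R a) <-> valid_mod A) /\
     (valid_mod A -> computes_per (cyclic_dft R a))).
Proof.
have C2 : (2 : R[i]) != 0 by rewrite pnatr_eq0.
have rI := @ryser_isolates R[i] n; have gI := glynn_isolates hn C2.
split; first by split; last exact: isolates_computes_per.
split; first by split; last exact: isolates_computes_per.
move=> N A a N_gt0 a_incr defA.
have a_inj : injective a.
  move=> i j eq_a; apply: val_inj; case: (ltngtP i j) => // /a_incr;
  by rewrite eq_a ltnn.
have isoP := cyclic_dft_isolatesP R N_gt0 a_inj defA.
by split=> // /isoP; apply: isolates_computes_per.
Qed.
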